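(* Let $\alpha>0$, $\omega\in\mathbb{R}$, $N\ge 1$, and $0<u_1<\dots<u_N$. For $t\ge 0$ let $\boldsymbol{\beta}=(\beta_1,\dots,\beta_N)'$ be the vector of coefficients of the prices $\boldsymbol{p}=(p_1,\dots,p_N)'$ in the affine representation $P(t)=\beta_0+\boldsymbol{\beta}'\boldsymbol{p}$ of the Smith-Wilson discount function at $t$ (with $\alpha$ held fixed). If $t>u_N$, then $$\mathrm{sign}(\beta_i)=(-1)^{N-i}\qquad\text{for } i=1,\dots,N.$$
   Context: Write $s\wedge t=\min(s,t)$ and $s\vee t=\max(s,t)$. The Wilson function is $$W(s,t)=e^{-\omega(s+t)}\left(\alpha(s\wedge t)-e^{-\alpha(s\vee t)}\sinh(\alpha(s\wedge t))\right),\qquad s,t\ge 0.$$ The Smith-Wilson discount function fitted to zero coupon bond prices $\boldsymbol{p}=(p_1,\dots,p_N)'$ at tenors $u_1,\dots,u_N$ is $P(t)=e^{-\omega t}+\sum_{j=1}^N\zeta_jW(t,u_j)$, where $\zeta_1,\dots,\zeta_N$ solve the linear system $P(u_i)=p_i$, $i=1,\dots,N$. It is the conditional expectation at $t$, given $\boldsymbol{Y}:=(Y_{u_1},\dots,Y_{u_N})'=\boldsymbol{p}$, of a Gaussian process $Y$ with mean function $e^{-\omega t}$ and covariance function $W$, so that $$P(t)=\mathbb{E}[Y_t]+\mathrm{Cov}[Y_t,\boldsymbol{Y}]\,\mathrm{Cov}[\boldsymbol{Y},\boldsymbol{Y}]^{-1}(\boldsymbol{p}-\mathbb{E}[\boldsymbol{Y}])=:\beta_0+\boldsymbol{\beta}'\boldsymbol{p}.$$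 Explicitly, $\boldsymbol{\beta}'=(W(t,u_1),\dots,W(t,u_N))\,\boldsymbol{W}^{-1}$ with $\boldsymbol{W}=(W(u_i,u_j))_{i,j=1,\dots,N}$. The quantities $\beta_0,\boldsymbol{\beta}$ depend on $t$ but not on $\boldsymbol{p}$, since $\alpha$ is a fixed parameter. Here $\mathrm{sign}(x)$ is $1$, $0$, $-1$ according to whether $x>0$, $x=0$, $x<0$. *)

(* Defs.v *)
From mathcomp Require Import all_boot all_order all_algebra.
From mathcomp Require Import reals sequences exp.

Set Implicit Arguments.
Unset Strict Implicit.
Unset Printing Implicit Defensive.

Import Order.TTheory GRing.Theory Num.Theory.
Local Open Scope ring_scope.

Definition sinh (R : realType) (x : R) : R := (expR x - expR (- x)) / 2.

Definition wilson (R : realType) (alpha omega s t : R) : R :=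
  expR (- omega * (s + t)) *
  (alpha * Num.min s t
   - expR (- alpha * Num.max s t) * sinh (alpha * Num.min s t)).

Section SmithWilson.
Variables (R : realType) (n : nat) (alpha omega : R) (u : 'I_n.+1 -> R).

(* N = n.+1; indices start at 0, so u i is the tenor u_(i+1). *)

Definition wilson_mx : 'M[R]_n.+1 := \matrix_(i, j) wilson alpha omega (u i) (u j).

Definition smith_wilson (zeta : 'cV[R]_n.+1) (t : R) : R :=
  expR (- omega * t) + \sum_(j < n.+1) zeta j 0 * wilson alpha omega t (u j).

Definition sw_fits (p zeta : 'cV[R]_n.+1) : Prop :=
  forall i, smith_wilson zeta (u i) = p i 0.

(* beta0 and beta may depend on t, but not on the prices p. *)
Definition sw_affine_coeffs (t beta0 : R) (beta : 'cV[R]_n.+1) : Prop :=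
  forall p zeta, sw_fits p zeta ->
    smith_wilson zeta t = beta0 + (beta^T *m p) 0 0.

Definition wilson_row (t : R) : 'rV[R]_n.+1 :=
  \row_j wilson alpha omega t (u j).

Definition sw_mean : 'cV[R]_n.+1 := \col_i expR (- omega * u i).

Lemma smith_wilsonE zeta t :
  smith_wilson zeta t = expR (- omega * t) + (wilson_row t *m zeta) 0 0.
Proof.
rewrite /smith_wilson mxE; congr (_ + _).
by apply: eq_bigr => j _; rewrite mxE mulrC.
Qed.

Lemma sw_fitsE p zeta : sw_fits p zeta <-> wilson_mx *m zeta = p - sw_mean.
Proof.
have E i : smith_wilson zeta (u i) = (sw_mean + wilson_mx *m zeta) i 0.
  rewrite smith_wilsonE !mxE; congr (_ + _).
  by apply: eq_bigr => j _; rewrite !mxE.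
split=> [fit|eqW i]; last by rewrite E eqW addrC subrK.
suff -> : p = sw_mean + wilson_mx *m zeta by rewrite addrC addKr.
by apply/colP => i; rewrite -E fit.
Qed.

Lemma sw_fits_unit p zeta : wilson_mx \in unitmx ->
  sw_fits p zeta <-> zeta = invmx wilson_mx *m (p - sw_mean).
Proof.
move=> uW; rewrite sw_fitsE; split=> [<-|->]; first by rewrite mulKmx.
by rewrite mulKVmx.
Qed.

(* For an invertible W the affine representation exists, is unique, and is
   given by beta' = (W(t, u_1), ..., W(t, u_N)) W^-1. *)
Lemma sw_affine_coeffsP t beta0 beta : wilson_mx \in unitmx ->
  sw_affine_coeffs t beta0 beta <->
  beta^T = wilson_row t *m invmx wilson_mx /\
  beta0 = expR (- omega * t)
          - (wilson_row t *m invmx wilson_mx *m sw_mean) 0 0.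
Proof.
move=> uW; set b := wilson_row t *m _.
have E p zeta : sw_fits p zeta -> smith_wilson zeta t =
    expR (- omega * t) - (b *m sw_mean) 0 0 + (b *m p) 0 0.
  move/(sw_fits_unit _ _ uW) => ->.
  by rewrite smith_wilsonE mulmxA -/b mulmxBr [X in _ + X]mxE [X in _ + (_ + X)]mxE addrCA addrC.
split=> [aff|[eb e0] p zeta /E ->]; last by rewrite eb e0.
have F (p : 'cV_n.+1) : expR (- omega * t) - (b *m sw_mean) 0 0 + (b *m p) 0 0 =
           beta0 + (beta^T *m p) 0 0.
  have fit : sw_fits p (invmx wilson_mx *m (p - sw_mean)) by apply/sw_fits_unit.
  by rewrite -(E _ _ fit) (aff _ _ fit).
have e0 : beta0 = expR (- omega * t) - (b *m sw_mean) 0 0.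
  by have := F 0; rewrite !mulmx0 !mxE !addr0.
split=> //; apply/rowP => j.
have := F (delta_mx j 0); rewrite e0 => /addrI.
by rewrite -!colE !mxE.
Qed.

End SmithWilson.

(* Main.v *)
Require Import Defs.
From mathcomp Require Import all_boot all_order all_algebra.
From mathcomp Require Import ring lra zify.
From mathcomp Require Import boolp normedtype derive.
From mathcomp Require Import reals sequences exp.

Import Order.TTheory GRing.Theory Num.Theory.
Import numFieldNormedType.Exports.
Local Open Scope ring_scope.

(* Up to the factor exp(- omega (s + t)) and the scaling by alpha, W is the
   kernel [ker], and between consecutive knots a combination F of its sections
   has the form p + q s + r e^s + w e^(- s). The equations defining beta say
   that some F, with knots u_1, ..., u_N, t and negative weight at t, vanishes
   at 0 and at every u_i.
   Across a gap where F vanishes at both ends, (F', F'') is transported by a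
   linear map which flips both signs when they agree; as F''(0) = 0, the values
   of F' and F'' at 0, u_1, ..., u_N alternate in sign, all of them being
   multiples of F'(0). Beyond t, F' = - F'', which extends the alternation of
   F'' to t. Finally the weight of a knot is, up to sign, the jump of the third
   derivative there, and the alternation of F'' determines the sign of this
   jump. With weight 0 at t the same argument gives F'(0) = 0, so W is
   invertible. *)

(** * Hyperbolic inequalities, and slopes across a gap in terms of second derivatives *)

Section Hyperbolic.
Variable R : realType.
Implicit Types x : R.

Definition cosh x : R := (expR x + expR (- x)) / 2.

Lemma gt0_of_derive_gt0 (f df : R -> R) x :
  f 0 = 0 -> (forall y : R, is_derive y 1 f (df y)) ->
  (forall y, 0 < y -> 0 < df y) -> 0 < x -> 0 < f x.
Proof.
move=> f0 fdf df_gt0 x_gt0.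
have fderivable : {in `[0, x], forall y, derivable f y 1}.
  by move=> y _; case: (fdf y).
have [y] := MVT x_gt0 (fun y _ => fdf y) (derivable_within_continuous fderivable).
rewrite in_itv /= => /andP[y_gt0 _]; rewrite f0 !subr0 => ->.
by rewrite mulr_gt0 ?df_gt0.
Qed.

Lemma cosh_gt1 x : 0 < x -> 1 < cosh x.
Proof.
move=> x_gt0; have e_gt1 : 1 < expR x by rewrite expR_gt1.
rewrite /cosh expRN ltr_pdivlMr // mul1r -subr_gt0.
have -> : expR x + (expR x)^-1 - 2 = (expR x - 1) ^+ 2 / expR x.
  by field; rewrite gt_eqF ?expR_gt0.
by rewrite divr_gt0 ?expR_gt0 // exprn_gt0 // subr_gt0.
Qed.

Lemma sinh_gtx x : 0 < x -> x < sinh x.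
Proof.
move=> x_gt0; rewrite -subr_gt0.
apply: (gt0_of_derive_gt0 (fun y => sinh y - y) (fun y => cosh y - 1)) => //.
- by rewrite /sinh oppr0 subrr mul0r addr0.
- move=> y; rewrite /sinh /cosh; apply: is_derive_eq.
  by rewrite /GRing.scale /=; field.
- by move=> y y_gt0; rewrite subr_gt0 cosh_gt1.
Qed.

Lemma sinh_gt0 x : 0 < x -> 0 < sinh x.
Proof. by move=> x_gt0; exact: lt_trans (sinh_gtx _ x_gt0). Qed.

Lemma cosh_gt0 x : 0 < cosh x.
Proof. by rewrite divr_gt0 ?addr_gt0 ?expR_gt0. Qed.

Lemma sqr_cosh x : cosh x ^+ 2 = sinh x ^+ 2 + 1.
Proof. by rewrite /cosh /sinh expRN; field; rewrite gt_eqF ?expR_gt0. Qed.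

(** Up to the factor [(e^x + 1) / (2 e^x)] the difference is [x (e^x + 1) - 2 (e^x - 1)], which
    vanishes at 0 and has derivative [1 + x e^x - e^x], positive because [e^(- x) > 1 - x]. *)
Lemma sinh2_lt x : 0 < x -> 2 * sinh x < x * (cosh x + 1).
Proof.
move=> x_gt0.
have e_gt1 : 1 < expR x by rewrite expR_gt1.
have : 0 < x * (expR x + 1) - 2 * (expR x - 1).
  apply: (gt0_of_derive_gt0 (fun y => y * (expR y + 1) - 2 * (expR y - 1))
    (fun y => 1 + y * expR y - expR y)) => //.
  - by rewrite expR0; ring.
  - move=> y; apply: is_derive_eq.
    by rewrite /GRing.scale /=; ring.
  - move=> y y_gt0.
    have := @expR_gt1Dx R (- y); rewrite oppr_eq0 gt_eqF // => /(_ isT).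
    rewrite expRN -(ltr_pM2r (expR_gt0 y)) mulVf ?gt_eqF ?expR_gt0 // => H.
    lra.
move=> H; rewrite -subr_gt0.
have -> : x * (cosh x + 1) - 2 * sinh x =
   (expR x + 1) / (2 * expR x) * (x * (expR x + 1) - 2 * (expR x - 1)).
  by rewrite /cosh /sinh expRN; field; rewrite gt_eqF ?expR_gt0.
by rewrite mulr_gt0 // divr_gt0 ?mulr_gt0 ?addr_gt0 ?expR_gt0.
Qed.

(* If F = p + q s + r e^s + w e^(- s) vanishes at both ends of a gap of length x,
   then the slope of F at an end is, up to sign, [near_slope x] times F'' at that
   end plus [far_slope x] times F'' at the other end. *)
Definition near_slope x := cosh x / sinh x - x^-1.
Definition far_slope x := x^-1 - (sinh x)^-1.

Lemma far_slope_gt0 x : 0 < x -> 0 < far_slope x.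
Proof.
by move=> x0; rewrite /far_slope subr_gt0 ltf_pV2 ?posrE ?sinh_gt0 ?sinh_gtx.
Qed.

Lemma far_slope_lt_near x : 0 < x -> far_slope x < near_slope x.
Proof.
move=> x0; have s0 := sinh_gt0 _ x0; rewrite -subr_gt0.
have -> : near_slope x - far_slope x =
   (x * (cosh x + 1) - 2 * sinh x) / (x * sinh x).
  by rewrite /near_slope /far_slope; field; rewrite !gt_eqF.
by rewrite divr_gt0 // ?subr_gt0 ?sinh2_lt // mulr_gt0.
Qed.

(* F = p + q s + r e^s + w e^(- s) on [a, b], with derivatives G = F' and
   H = F''. *)
Definition exp_affine (a b : R) (F G H : R -> R) := exists p q r w : R,
  forall s, a <= s <= b -> [/\ F s = p + q * s + r * expR s + w * expR (- s),
     G s = q + r * expR s - w * expR (- s) & H s = r * expR s + w * expR (- s)].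

Lemma expR_gap (a b : R) :
  expR b = expR a * (cosh (b - a) + sinh (b - a)) /\
  expR (- b) = expR (- a) * (cosh (b - a) - sinh (b - a)).
Proof.
rewrite /cosh /sinh opprB !expRD !expRN.
by split; field; rewrite ?gt_eqF ?expR_gt0.
Qed.

(** [F - H] is affine, and [H] is fixed by its end values through [sinh (s - a)] and [sinh (b - s)];
    differentiating both parts gives the slopes. *)
Lemma exp_affine_slopes a b F G H : a < b -> exp_affine a b F G H ->
  G a = (F b - F a) / (b - a) - near_slope (b - a) * H a - far_slope (b - a) * H b /\
  G b = (F b - F a) / (b - a) + far_slope (b - a) * H a + near_slope (b - a) * H b.
Proof.
move=> ab [p [q [r [w E]]]].
have [-> -> ->] : [/\ F a = p + q * a + r * expR a + w * expR (- a),
     G a = q + r * expR a - w * expR (- a) & H a = r * expR a + w * expR (- a)].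
  by apply: E; rewrite lexx ltW.
have [-> -> ->] : [/\ F b = p + q * b + r * expR b + w * expR (- b),
     G b = q + r * expR b - w * expR (- b) & H b = r * expR b + w * expR (- b)].
  by apply: E; rewrite lexx ltW.
have d0 : 0 < b - a by rewrite subr_gt0.
have [-> ->] := expR_gap a b.
have s0 := sinh_gt0 _ d0; have := sqr_cosh (b - a).
rewrite /near_slope /far_slope; move: (cosh _) (sinh _) s0 => C S s0 C2.
(* [field] does not know that [C^2 - S^2 = 1]; writing this into [far_slope] turns the second
   identity into a rational one. *)
have fE : (b - a)^-1 - S^-1 = (b - a)^-1 - (C ^+ 2 - S ^+ 2) / S.
  by rewrite C2 addrAC subrr add0r mul1r.
by split; last rewrite fE; field; rewrite !gt_eqF.
Qed.

(** This is the integral of [H] over the gap; the factor is [tanh ((b - a) / 2)]. No value of [F]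
    enters, so it serves the gap before [t], where [F] is not known to vanish at the right end. *)
Lemma exp_affine_increment a b F G H : a < b -> exp_affine a b F G H ->
  G b - G a = (cosh (b - a) - 1) / sinh (b - a) * (H a + H b).
Proof.
move=> ab [p [q [r [w E]]]].
have [_ -> ->] : [/\ F a = p + q * a + r * expR a + w * expR (- a),
     G a = q + r * expR a - w * expR (- a) & H a = r * expR a + w * expR (- a)].
  by apply: E; rewrite lexx ltW.
have [_ -> ->] : [/\ F b = p + q * b + r * expR b + w * expR (- b),
     G b = q + r * expR b - w * expR (- b) & H b = r * expR b + w * expR (- b)].
  by apply: E; rewrite lexx ltW.
have d0 : 0 < b - a by rewrite subr_gt0.
have [-> ->] := expR_gap a b.
have s0 := sinh_gt0 _ d0; have := sqr_cosh (b - a).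
move: (cosh _) (sinh _) s0 => C S s0 C2.
have T1 : (C - 1) / S * S = C - 1 by rewrite divfK ?gt_eqF.
have T2 : (C - 1) / S * (C + 1) = S.
  by rewrite mulrAC -subr_sqr expr1n C2 addrK expr2 mulfK ?gt_eqF.
move: ((C - 1) / S) T1 T2 => T T1 T2.
move: (expR a) (expR (- a)) => X Y.
have := congr1 (fun z => r * X * z) T1; have := congr1 (fun z => r * X * z) T2.
have := congr1 (fun z => w * Y * z) T1; have := congr1 (fun z => w * Y * z) T2.
rewrite /=; lra.
Qed.
End Hyperbolic.

Arguments cosh {R} x.
Arguments near_slope {R} x.
Arguments far_slope {R} x.
Arguments exp_affine {R} a b F G H.

(** * The kernel, its derivatives, and the jump of the third derivative *)

Section Kernel.
Variable R : realType.
Implicit Types (a b s x y : R) (F G H : R -> R).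

Lemma exp_affine_sum a b (I : Type) (r : seq I) (P : pred I) (c : I -> R)
    (F G H : I -> R -> R) :
  (forall i, P i -> exp_affine a b (F i) (G i) (H i)) ->
  exp_affine a b (fun s => \sum_(i <- r | P i) c i * F i s)
    (fun s => \sum_(i <- r | P i) c i * G i s)
    (fun s => \sum_(i <- r | P i) c i * H i s).
Proof.
move=> FGH; elim: r => [|i r [p [q [k [w IH]]]]].
  by exists 0, 0, 0, 0 => s _; rewrite !big_nil; split; ring.
case Pi : (P i); last first.
  exists p, q, k, w => s /IH[E1 E2 E3].
  by rewrite !big_cons Pi E1 E2 E3.
have [p' [q' [k' [w' E]]]] := FGH i Pi.
exists (c i * p' + p), (c i * q' + q), (c i * k' + k), (c i * w' + w) => s sab.
have [E1 E2 E3] := IH s sab; have [E1' E2' E3'] := E s sab.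
by rewrite !big_cons Pi E1 E2 E3 E1' E2' E3'; split; ring.
Qed.

(* The jump H'(x-) - H'(x+) of a function H which is a combination of e^s and
   e^(- s) on [a, x] and on [x, b], in terms of its values. *)
Definition kink a x b H : R :=
  (H x * cosh (x - a) - H a) / sinh (x - a)
  - (H b - H x * cosh (b - x)) / sinh (b - x).

Lemma exp_affine_kink a x b F G H : a < x -> x < b ->
  exp_affine a b F G H -> kink a x b H = 0.
Proof.
move=> ax xb [p [q [r [w E]]]].
have H_ s : a <= s <= b -> H s = r * expR s + w * expR (- s) by move=> /E[].
have ab := lt_trans ax xb.
rewrite /kink !H_ ?lexx ?ltW //.
have [-> ->] := expR_gap R x b.
have -> : expR a = expR x * (cosh (x - a) - sinh (x - a)).
  by rewrite /cosh /sinh opprB !expRD !expRN; field; rewrite ?gt_eqF ?expR_gt0.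
have -> : expR (- a) = expR (- x) * (cosh (x - a) + sinh (x - a)).
  by rewrite /cosh /sinh opprB !expRD !expRN; field; rewrite ?gt_eqF ?expR_gt0.
have s1 : 0 < sinh (x - a) by rewrite sinh_gt0 ?subr_gt0.
have s2 : 0 < sinh (b - x) by rewrite sinh_gt0 ?subr_gt0.
by field; rewrite !gt_eqF.
Qed.

(* [dker] and [ddker] are the first two derivatives of [ker] in s. *)
Definition ker s v : R :=
  if s <= v then s - expR (- v) * sinh s else v - sinh v * expR (- s).
Definition dker s v : R :=
  if s <= v then 1 - expR (- v) * cosh s else sinh v * expR (- s).
Definition ddker s v : R :=
  if s <= v then - (expR (- v) * sinh s) else - (sinh v * expR (- s)).

(** The two branches agree at [s = v] together with two derivatives, so a closed interval may touch
    the knot from either side. *)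
Lemma ker_exp_affine a b v : b <= v \/ v <= a ->
  exp_affine a b (ker ^~ v) (dker ^~ v) (ddker ^~ v).
Proof.
case=> [bv|va].
  exists 0, 1, (- expR (- v) / 2), (expR (- v) / 2) => s /andP[_ sb].
  rewrite /ker /dker /ddker (le_trans sb bv) /sinh /cosh.
  by split; field.
exists v, 0, 0, (- sinh v) => s /andP[sa _].
have vs := le_trans va sa.
rewrite /ker /dker /ddker; case: ifP => [sv|_]; last by split; ring.
have -> : s = v by apply: le_anti; rewrite sv.
by rewrite /sinh /cosh expRN; split; field; rewrite gt_eqF ?expR_gt0.
Qed.

Lemma ker_tail s v : v <= s ->
  dker s v = - ddker s v /\ ddker s v = - (sinh v * expR (- s)).
Proof.
move=> vs; rewrite /dker /ddker; case: ifP => [sv|_]; last by rewrite opprK.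
have -> : s = v by apply: le_anti; rewrite sv.
by rewrite /sinh /cosh expRN; split; field; rewrite gt_eqF ?expR_gt0.
Qed.

(** The one-sided derivatives at [x] are [- e^(- x) cosh x] and [e^(- x) sinh x], and
    [cosh x + sinh x = e^x]. *)
Lemma kink_ddker a x b : a < x -> x < b -> kink a x b (ddker ^~ x) = - 1.
Proof.
move=> ax xb; rewrite /kink /ddker lexx (ltW ax) leNgt xb /=.
have s1 : 0 < sinh (x - a) by rewrite sinh_gt0 ?subr_gt0.
have s2 : 0 < sinh (b - x) by rewrite sinh_gt0 ?subr_gt0.
have -> : sinh a = sinh x * cosh (x - a) - cosh x * sinh (x - a).
  by rewrite /cosh /sinh opprB !expRD !expRN; field; rewrite ?gt_eqF ?expR_gt0.
have -> : expR (- b) = expR (- x) * (cosh (b - x) - sinh (b - x)).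
  by rewrite /cosh /sinh opprB !expRD !expRN; field; rewrite ?gt_eqF ?expR_gt0.
have E : expR (- x) * (sinh x + cosh x) = 1.
  by rewrite /cosh /sinh !expRN; field; rewrite ?gt_eqF ?expR_gt0.
by rewrite -E; field; rewrite !gt_eqF.
Qed.

Lemma kinkD a x b H1 H2 k :
  kink a x b (fun s => k * H1 s + H2 s) = k * kink a x b H1 + kink a x b H2.
Proof. by rewrite /kink; ring. Qed.

Lemma kerC s v : ker s v = ker v s.
Proof.
by rewrite /ker; case: ltgtP => [_|_|->]; ring.
Qed.

Lemma kerE s v : ker s v = Num.min s v - expR (- Num.max s v) * sinh (Num.min s v).
Proof. by rewrite /ker; case: leP => // _; rewrite mulrC. Qed.

Lemma ker0 v : 0 <= v -> ker 0 v = 0.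
Proof. by move=> v0; rewrite /ker v0 /sinh oppr0 subrr mul0r mulr0 subr0. Qed.

Lemma ddker0 v : 0 <= v -> ddker 0 v = 0.
Proof. by move=> v0; rewrite /ddker v0 /sinh oppr0 subrr mul0r mulr0 oppr0. Qed.

Lemma wilsonE alpha omega s v : 0 <= alpha ->
  wilson alpha omega s v =
  expR (- omega * s) * expR (- omega * v) * ker (alpha * s) (alpha * v).
Proof.
move=> a0; rewrite /wilson kerE -minr_pMr // -maxr_pMr // (mulrDr (- omega)) expRD.
by rewrite (mulNr alpha).
Qed.

End Kernel.

Arguments kink {R} a x b H.
Arguments ker {R} s v.
Arguments dker {R} s v.
Arguments ddker {R} s v.

(** * Sign alternation for kernel splines that vanish at all knots but the last *)

Section Spline.
Variables (R : realType) (n : nat) (v c : nat -> R).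
Hypotheses (v0 : v 0%N = 0) (v_incr : forall j, v j < v j.+1).

(** The weight [c m] sits at the knot [v m.+1], since [v 0] is the origin; [v n.+2] stands for [t].
    Taking [dker] or [ddker] for [K] gives the derivatives. *)
Definition spline (K : R -> R -> R) (s : R) : R :=
  \sum_(m < n.+2) c m * K s (v m.+1).

Lemma knot_leq i j : (i <= j)%N -> v i <= v j.
Proof. by apply: (homo_leq lexx le_trans) => k; exact: ltW. Qed.

Lemma spline_exp_affine j : exp_affine (v j) (v j.+1)
  (spline ker) (spline dker) (spline ddker).
Proof.
apply: exp_affine_sum => m _; apply: ker_exp_affine.
by case: (leqP j m) => jm; [left | right]; apply: knot_leq.
Qed.

Lemma spline_tail s : v n.+2 <= s -> spline dker s = - spline ddker s.
Proof.
move=> vs; rewrite /spline -sumrN; apply: eq_bigr => m _.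
have vm : v m.+1 <= s by apply: le_trans vs; apply: knot_leq; rewrite ltn_ord.
by have [-> _] := ker_tail _ _ _ vm; rewrite mulrN.
Qed.

Lemma spline_tail_decay s : v n.+2 <= s ->
  spline ddker s = expR (v n.+2 - s) * spline ddker (v n.+2).
Proof.
move=> vs; rewrite /spline mulr_sumr; apply: eq_bigr => m _.
have vm : v m.+1 <= v n.+2 by apply: knot_leq; rewrite ltn_ord.
have [_ ->] := ker_tail _ _ _ (le_trans vm vs).
have [_ ->] := ker_tail _ _ _ vm.
rewrite expRD !expRN.
by field; rewrite !gt_eqF ?expR_gt0.
Qed.

(** On [[v m, v m.+2]] every section except the one at [v m.+1] is a single [exp_affine] piece and
    has no kink. *)
Lemma spline_kink (m : 'I_n.+2) :
  kink (v m) (v m.+1) (v m.+2) (spline ddker) = - c m.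
Proof.
pose rest (K : R -> R -> R) s := \sum_(i < n.+2 | i != m) c i * K s (v i.+1).
have -> : spline ddker =
    fun s => c m * (ddker ^~ (v m.+1)) s + rest ddker s.
  by apply/funext => s; rewrite /spline (bigD1 m).
rewrite kinkD kink_ddker // mulrN1.
suff -> : kink (v m) (v m.+1) (v m.+2) (rest ddker) = 0 by rewrite addr0.
apply: (exp_affine_kink _ _ _ _ (rest ker) (rest dker)) => //.
apply: exp_affine_sum => i im; apply: ker_exp_affine.
case: (ltngtP i m) => [lt_im|lt_mi|/val_inj e].
- by right; apply: knot_leq.
- by left; apply: knot_leq.
- by rewrite e eqxx in im.
Qed.

Hypothesis spline0 : forall j, (0 < j <= n.+1)%N -> spline ker (v j) = 0.

Lemma spline_knot0 j : (j <= n.+1)%N -> spline ker (v j) = 0.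
Proof.
case: j => [_|j jn]; last exact: spline0.
rewrite /spline big1 // => m _; rewrite v0 ker0 ?mulr0 //.
by rewrite -v0 knot_leq.
Qed.

Lemma spline_alternate j : (j <= n.+1)%N -> exists A B : R,
  [/\ 0 < A, 0 <= B, (0 < j)%N -> 0 < B,
      spline dker (v j) = (-1) ^+ j * A * spline dker 0
    & spline ddker (v j) = (-1) ^+ j * B * spline dker 0].
Proof.
elim: j => [_|j IH jn].
  exists 1, 0; split => //; rewrite v0; first by ring.
  rewrite mulr0 mul0r /spline big1 // => m _.
  by rewrite ddker0 ?mulr0 // -v0 knot_leq.
have [A [B [A0 B0 _ EG EH]]] := IH (ltnW jn).
have d0 : 0 < v j.+1 - v j by rewrite subr_gt0.
have e0 := far_slope_gt0 _ _ d0; have ec := far_slope_lt_near _ _ d0.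
(* Both ends are zeros of the spline: the equation for the left slope is solved for the second
   derivative at the right end, and the other equation then gives the slope there. *)
have [] := exp_affine_slopes _ _ _ _ _ _ (v_incr j) (spline_exp_affine j).
rewrite EG EH !spline_knot0 // ?(ltnW jn) // subrr mul0r sub0r add0r.
move: (near_slope _) (far_slope _) e0 ec => p q q0 qp Ea Eb.
have p0 := lt_trans q0 qp.
have B'0 : 0 < (A + p * B) / q by rewrite divr_gt0 // ltr_wpDr // mulr_ge0 // ltW.
have EHb : spline ddker (v j.+1) =
    (-1) ^+ j.+1 * ((A + p * B) / q) * spline dker 0.
  apply: (mulfI (lt0r_neq0 q0)); rewrite exprS.
  transitivity (- ((-1) ^+ j * A * spline dker 0)
    - p * ((-1) ^+ j * B * spline dker 0)).
    by rewrite Ea; ring.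
  by field; rewrite gt_eqF.
exists (p * ((A + p * B) / q) - q * B), ((A + p * B) / q).
split=> //; first last.
- by rewrite Eb EHb exprS; ring.
- exact: ltW.
(* The new slope factor is positive because [far_slope] lies below [near_slope]. *)
have -> : p * ((A + p * B) / q) - q * B = (p * A + (p ^+ 2 - q ^+ 2) * B) / q.
  by field; rewrite gt_eqF.
rewrite divr_gt0 // ltr_wpDr ?mulr_gt0 // mulr_ge0 // subr_ge0 ltW //.
by rewrite ltr_pXn2r // nnegrE ltW.
Qed.

Lemma ddspline_alternate j : (j <= n.+2)%N -> exists B : R,
  [/\ 0 <= B, (0 < j)%N -> 0 < B
    & spline ddker (v j) = (-1) ^+ j * B * spline dker 0].
Proof.
rewrite leq_eqVlt ltnS => /orP[/eqP->|/spline_alternate[A [B []]]]; last by exists B.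
have [A [B [A0 B0 _ EG EH]]] := spline_alternate n.+1 (leqnn _).
have d0 : 0 < v n.+2 - v n.+1 by rewrite subr_gt0.
(* With [F' = - F''] at [v n.+2] this reads [(1 + T) F''(v n.+2) = - F'(v n.+1) - T F''(v n.+1)]. *)
have := exp_affine_increment _ _ _ _ _ _ (v_incr n.+1) (spline_exp_affine n.+1).
rewrite spline_tail // EG EH; set T := (_ / _) => ET.
have T0 : 0 < T by rewrite divr_gt0 ?sinh_gt0 // subr_gt0 cosh_gt1.
have B'0 : 0 < (A + T * B) / (1 + T).
  by rewrite divr_gt0 ?(addr_gt0 ltr01) // ltr_wpDr // mulr_ge0 // ltW.
exists ((A + T * B) / (1 + T)); split => //; first exact: ltW.
have T1 : 1 + T != 0 by rewrite gt_eqF // addr_gt0.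
apply: (mulfI T1).
transitivity (- ((-1) ^+ n.+1 * A * spline dker 0)
    - T * ((-1) ^+ n.+1 * B * spline dker 0)).
  by move: ET; move: (spline ddker _) (spline dker _) => x y; lra.
by rewrite [_ ^+ n.+2]exprS; field.
Qed.

(** In the kink the neighbouring values of [F''] are subtracted from that at the knot, so
    alternation makes the terms reinforce each other. As the kink is [- c m], the sign is [(-1)^m]
    although the knot is [v m.+1]. *)
Lemma spline_coef_alternate (m : 'I_n.+2) : exists C : R,
  0 < C /\ c m = (-1) ^+ m * C * spline dker 0.
Proof.
have [Ba [Ba0 _ EHa]] := ddspline_alternate m (ltnW (ltn_ord m)).
have [Bx [_ /(_ isT) Bx0 EHx]] := ddspline_alternate m.+1 (ltn_ord m).
have := spline_kink m; rewrite /kink EHa EHx.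
have d0 : 0 < v m.+1 - v m by rewrite subr_gt0.
have d'0 : 0 < v m.+2 - v m.+1 by rewrite subr_gt0.
have S0 := sinh_gt0 _ _ d0; have S'0 := sinh_gt0 _ _ d'0.
have C0 := cosh_gt0 _ (v m.+1 - v m).
have C'0 := cosh_gt0 _ (v m.+2 - v m.+1).
(* After the last knot F'' keeps its sign, but it decays fast enough. *)
have [Z [Z0 EHb]] : exists Z, 0 < Bx * cosh (v m.+2 - v m.+1) + Z /\
    spline ddker (v m.+2) = (-1) ^+ m * Z * spline dker 0.
  have := ltn_ord m; rewrite leq_eqVlt => /orP[/eqP|]; rewrite ?ltnS => mn.
    case: mn => mn; exists (- (Bx * expR (- (v m.+2 - v m.+1)))); split.
      rewrite -mulrBr mulr_gt0 //.
      suff -> : cosh (v m.+2 - v m.+1) - expR (- (v m.+2 - v m.+1)) =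
        sinh (v m.+2 - v m.+1) by [].
      by rewrite /cosh /sinh; field.
    rewrite spline_tail_decay mn; last exact: ltW.
    by rewrite mn in EHx; rewrite EHx opprB exprS; ring.
  have [B [B0 _ EH]] := ddspline_alternate m.+2 mn.
  exists B; split; last by rewrite EH !exprS; ring.
  by rewrite ltr_wpDr // mulr_gt0.
rewrite EHb exprS => E.
exists ((Bx * cosh (v m.+1 - v m) + Ba) / sinh (v m.+1 - v m)
  + (Bx * cosh (v m.+2 - v m.+1) + Z) / sinh (v m.+2 - v m.+1)); split.
  by apply: addr_gt0; apply: divr_gt0 => //; apply: ltr_wpDr => //; apply: mulr_gt0.
by rewrite -[c m]opprK -E; ring.
Qed.

End Spline.

(** * Transfer to the Wilson function, and the theorem *)

(** The free factor [g] covers two uses: [g = 0] shows that the Wilson matrix has trivial left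
    kernel, and [g = 1] gives the signs of beta. *)
Lemma wilson_combination_alternate (R : realType) (n : nat) (alpha omega : R)
    (u : 'I_n.+1 -> R) (t g : R) (b : 'I_n.+1 -> R) :
  0 < alpha -> 0 < u ord0 -> (forall i j : 'I_n.+1, (i < j)%N -> u i < u j) ->
  u ord_max < t ->
  (forall i, \sum_j b j * wilson alpha omega (u j) (u i) =
    g * wilson alpha omega t (u i)) ->
  forall j, exists C : R, 0 < C /\ b j = (-1) ^+ (n - j) * C * g.
Proof.
move=> al0 u0 u_incr ut E j.
(* The knots are continued past t only to make [v] increasing everywhere. *)
pose v k := if k is k'.+1 then
  if (k' <= n)%N then alpha * u (inord k') else alpha * t + (k' - n.+1)%:R else 0.
pose c k := if (k <= n)%N then b (inord k) * expR (- omega * u (inord k))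
            else - g * expR (- omega * t).
have v_incr k : v k < v k.+1.
  have inord_0 : inord 0 = ord0 :> 'I_n.+1 by apply/val_inj; rewrite /= inordK.
  have inord_n : inord n = ord_max :> 'I_n.+1 by apply/val_inj; rewrite /= inordK.
  case: k => [|k] /=; first by rewrite inord_0 mulr_gt0.
  case: (ltngtP k n) => [kn|nk|->]; last first.
  - by rewrite subnn addr0 ltr_pM2l // inord_n.
  - by rewrite ltrD2l ltr_nat ltn_sub2r.
  - by rewrite ltr_pM2l // u_incr // !inordK // ltnW.
have vE (i : 'I_n.+1) : v i.+1 = alpha * u i.
  by rewrite /= -ltnS ltn_ord inord_val.
have vt : v n.+2 = alpha * t by rewrite /= ltnn subnn addr0.
have cE (i : 'I_n.+1) : c i = b i * expR (- omega * u i).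
  by rewrite /c -ltnS ltn_ord inord_val.
have ct : c n.+1 = - g * expR (- omega * t) by rewrite /c ltnn.
have F0 k : (0 < k <= n.+1)%N -> spline R n v c ker (v k) = 0.
  case: k => // k kn; rewrite (vE (Ordinal (kn : (k < n.+1)%N))).
  set s := alpha * _.
  have -> : spline R n v c ker s =
      \sum_(i < n.+1) c i * ker s (v i.+1) + c n.+1 * ker s (v n.+2).
    exact: big_ord_recr.
  rewrite vt ct.
  (* The exponential factor at [u i], absent from [ker], is restored to recover [wilson]. *)
  apply: (mulfI (lt0r_neq0 (expR_gt0 (- omega * u (Ordinal (kn : (k < n.+1)%N)))))).
  rewrite mulr0 mulrDr mulr_sumr.
  set i := Ordinal _ in s *.
  transitivity (\sum_j b j * wilson alpha omega (u j) (u i)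
    - g * wilson alpha omega t (u i)); last by rewrite E subrr.
  rewrite wilsonE ?ltW //; congr (_ + _).
    by apply: eq_bigr => l _; rewrite cE vE wilsonE ?ltW // kerC /s; ring.
  by rewrite kerC /s; ring.
have alt := spline_coef_alternate R n v c (erefl _) v_incr F0.
(* The weight at [t] is known, so its formula eliminates the slope [g0] at 0 in favour of [g]. *)
have [Ct [Ct0]] := alt ord_max; rewrite /= ct => Eg.
have [Cj [Cj0]] := alt (widen_ord (leqnSn _) j); rewrite /= cE => Ej.
set g0 := spline _ _ _ _ _ _ in Eg Ej.
have x0 := expR_gt0 (- omega * t); have y0 := expR_gt0 (- omega * u j).
exists (Cj * expR (- omega * t) / Ct / expR (- omega * u j)); split.
  by rewrite !divr_gt0 // mulr_gt0.
have jn : (j <= n)%N by rewrite -ltnS.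
have sgn : (-1) ^+ (n - j) * (-1) ^+ n.+1 = - (-1) ^+ j :> R.
  by rewrite -exprD -signr_odd (_ : odd _ = ~~ odd j) ?signrN ?signr_odd //; lia.
apply: (mulIf (lt0r_neq0 y0)); rewrite Ej.
transitivity ((-1) ^+ (n - j) * Cj / Ct * (g * expR (- omega * t))); last first.
  by field; rewrite !gt_eqF.
rewrite -[g * _]opprK -mulNr Eg.
transitivity (- ((-1) ^+ (n - j) * (-1) ^+ n.+1) * Cj * g0); last first.
  by field; rewrite gt_eqF.
by rewrite sgn opprK.
Qed.

Theorem theorem2 (R : realType) (n : nat) (alpha omega : R)
    (u : 'I_n.+1 -> R) (t : R) :
  0 < alpha ->
  0 < u ord0 ->
  (forall i j : 'I_n.+1, (i < j)%N -> u i < u j) ->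
  0 <= t ->
  u ord_max < t ->
  wilson_mx alpha omega u \in unitmx /\
  forall (beta0 : R) (beta : 'cV[R]_n.+1),
    sw_affine_coeffs alpha omega u t beta0 beta ->
    forall i : 'I_n.+1, Num.sg (beta i 0) = (-1) ^+ (n - i).
Proof.
move=> al0 u0 u_incr _ ut.
have alt g b := wilson_combination_alternate R n alpha omega u t g b al0 u0 u_incr ut.
have W_unit : wilson_mx alpha omega u \in unitmx.
  rewrite -row_free_unit; apply: inj_row_free => b bW; apply/rowP => j.
  have [|C [_ ->]] := alt 0 (b 0) _ j; last by rewrite mulr0 mxE.
  move=> i; rewrite mul0r.
  transitivity ((b *m wilson_mx alpha omega u) 0 i); last by rewrite bW mxE.
  by rewrite mxE; apply: eq_bigr => k _; rewrite !mxE.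
split=> // beta0 beta /(sw_affine_coeffsP _ _ _ W_unit)[Eb _] i.
(* With indices from 0, the exponent [n - i] is [N - (i + 1)] for the tenor numbered [i + 1]. *)
have [|C [C0 ->]] := alt 1 (beta ^~ 0) _ i; last first.
  by rewrite mulr1 sgrM (gtr0_sg C0) mulr1 sgrX sgrN1.
move=> k; rewrite mul1r.
have /rowP/(_ k) : beta^T *m wilson_mx alpha omega u = wilson_row alpha omega u t.
  by rewrite Eb mulmxKV.
by rewrite !mxE => <-; apply: eq_bigr => j _; rewrite !mxE.
Qed.
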